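(* Let $k$ and $b$ be two nonnegative integers with $k\geq\max\{5,b+3\}$ and $(b,k)\neq(2,5)$, and let $G$ be a connected graph of order $n\geq k+b+2$. If $$\rho(G)\geq\rho\bigl(K_1\vee(K_{n-k-b-1}\cup(k+b)K_1)\bigr),$$ then $G$ contains a spanning tree $T$ with $\mathrm{te}(T,k)\leq b$, unless $G=K_1\vee(K_{n-k-b-1}\cup(k+b)K_1)$.
   Context: All graphs are finite, undirected, without loops or multiple edges. $\rho(G)$ denotes the adjacency spectral radius of $G$, i.e. the largest eigenvalue of its adjacency matrix. $K_m$ is the complete graph on $m$ vertices, $mK_1$ is the graph consisting of $m$ isolated vertices, $G_1\cup G_2$ is the disjoint union, and $G_1\vee G_2$ (join) is obtained from $G_1\cup G_2$ by joining every vertex of $G_1$ to every vertex of $G_2$. For a spanning tree $T$ of $G$ and a nonnegative integer $k$, the total $k$-excess is $\mathrm{te}(T,k)=\sum_{v\in V(T)}\max\{0,d_T(v)-k\}$, where $d_T(v)$ is the degree of $v$ in $T$. *)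

(* Defs.v *)
From mathcomp Require Import all_boot all_order all_algebra.
From mathcomp Require Import boolp classical_sets reals.

Set Implicit Arguments.
Unset Strict Implicit.
Unset Printing Implicit Defensive.

Import Order.TTheory GRing.Theory Num.Theory.

Record sgraph (V : finType) := SGraph {
  edge :> rel V;
  edge_sym : symmetric edge;
  edge_irr : irreflexive edge }.

Section BasicGraphs.
Variable m : nat.

Definition complete_rel : rel 'I_m := fun x y => x != y.
Fact complete_sym : symmetric complete_rel.
Proof. by move=> x y; rewrite /complete_rel eq_sym. Qed.
Fact complete_irr : irreflexive complete_rel.
Proof. by move=> x; rewrite /complete_rel eqxx. Qed.
Definition complete_graph : sgraph 'I_m := SGraph complete_sym complete_irr.

Definition edgeless_rel : rel 'I_m := fun _ _ => false.
Fact edgeless_sym : symmetric edgeless_rel. Proof. by []. Qed.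
Fact edgeless_irr : irreflexive edgeless_rel. Proof. by []. Qed.
Definition edgeless_graph : sgraph 'I_m := SGraph edgeless_sym edgeless_irr.

End BasicGraphs.

Section Constructions.
Variables (V W : finType) (G : sgraph V) (H : sgraph W).

Definition union_rel : rel (V + W)%type := fun x y =>
  match x, y with
  | inl a, inl b => G a b
  | inr a, inr b => H a b
  | _, _ => false
  end.
Fact union_sym : symmetric union_rel.
Proof. by move=> [a|a] [b|b] //=; apply: edge_sym. Qed.
Fact union_irr : irreflexive union_rel.
Proof. by move=> [a|a] /=; apply: edge_irr. Qed.
Definition disjoint_union : sgraph (V + W)%type := SGraph union_sym union_irr.

Definition join_rel : rel (V + W)%type := fun x y =>
  match x, y with
  | inl a, inl b => G a b
  | inr a, inr b => H a b
  | _, _ => true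
  end.
Fact join_sym : symmetric join_rel.
Proof. by move=> [a|a] [b|b] //=; apply: edge_sym. Qed.
Fact join_irr : irreflexive join_rel.
Proof. by move=> [a|a] /=; apply: edge_irr. Qed.
Definition join : sgraph (V + W)%type := SGraph join_sym join_irr.

Definition isomorphic : Prop :=
  exists f : V -> W, bijective f /\ forall x y, H (f x) (f y) = G x y.

End Constructions.

Section Trees.
Variable V : finType.
Implicit Types G T : sgraph V.

Definition degree G (v : V) : nat := #|[set w | G v w]|.

Definition connected G : Prop := forall x y, connect G x y.

(* A cycle needs at least three vertices: [:: x] with a loop is excluded by
   irreflexivity, but [:: x; y] is a [ucycle] as soon as x and y are adjacent. *)
Definition acyclic G : Prop := forall c : seq V, 2 < size c -> ~ ucycle G c.

Definition is_tree G : Prop := connected G /\ acyclic G.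

Definition spanning_tree G T : Prop := is_tree T /\ subrel T G.

(* Truncated subtraction: degree T v - k is max(0, d_T(v) - k). *)
Definition total_excess T (k : nat) : nat := \sum_(v : V) (degree T v - k).

End Trees.

Section SpectralRadius.
Local Open Scope ring_scope.
Variables (R : realType) (V : finType).
Implicit Type G : sgraph V.

Definition adjacency_mx G : 'M[R]_#|V| :=
  \matrix_(i, j) (G (enum_val i) (enum_val j))%:R.

Definition is_largest_eigenvalue G (x : R) : Prop :=
  eigenvalue (adjacency_mx G) x /\
  forall y, eigenvalue (adjacency_mx G) y -> y <= x.

(* A real symmetric matrix has real eigenvalues, so for nonempty V the default
   value 0 of [xget] is not used. *)
Definition spectral_radius G : R := xget 0 (is_largest_eigenvalue G).

End SpectralRadius.

(* K_1 v (K_(n-k-b-1) U (k+b) K_1); of order n when k + b + 1 <= n. *)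
Definition extremal_graph (n k b : nat) :
    sgraph ('I_1 + ('I_(n - k - b - 1) + 'I_(k + b)))%type :=
  join (complete_graph 1)
    (disjoint_union (complete_graph (n - k - b - 1)) (edgeless_graph (k + b))).

(* Main.v *)
Require Import Defs.
From mathcomp Require Import all_boot all_order all_algebra.
From mathcomp Require Import zify ring lra.
From mathcomp Require Import boolp reals.

(* If no spanning tree has total k-excess at most b, take a spanning tree T of
   minimal total excess and S = {v | d_T(v) >= k}. While an edge xy of G joins two
   components of T - S, the T-path from x to y meets S only in vertices of degree
   exactly k, since otherwise exchanging an edge of that path for xy would lower
   the excess; by the same exchange these vertices can be brought below degree k, so
   they may be dropped from S. When this stops, G - S has at least
   (k-2)|S| + b + 3 components, by counting the edges of T at S.
   Let s = |S|, let lam be the index of the extremal graph and give weight 1 to the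
   vertices of S and s / (lam + 1 - m) to those in a component of size m of G - S. By
   convexity this is a supersolution of A x <= lam x; for s >= 2 it is strict
   on S because lam > n - k - b - 1, and for s = 1 it is tight only for the extremal
   graph. As G is connected, a supersolution that is not tight gives rho(G) < lam. *)

Set Implicit Arguments.
Unset Strict Implicit.
Unset Printing Implicit Defensive.

Import Order.TTheory GRing.Theory Num.Theory.

(** * Trees given by a parent function *)

Section RelDegree.
Variable V : finType.
Implicit Types e : rel V.

Definition rel_degree e v := #|[set w | e v w]|.
Definition rel_excess k e := \sum_v (rel_degree e v - k).

Lemma rel_degreeS e e' v :
  (forall w, e v w -> e' v w) -> rel_degree e v <= rel_degree e' v.
Proof.
by move=> ee'; apply/subset_leq_card/subsetP => w; rewrite !inE => /ee'.
Qed.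

Lemma rel_degree_leS e e' v c :
  (forall w, e v w -> e' v w || (w == c)) -> rel_degree e v <= (rel_degree e' v).+1.
Proof.
move=> ee'; rewrite -add1n -(cards1 c); apply: leq_trans (leq_card_setU _ _).
apply/subset_leq_card/subsetP => w; rewrite !inE => /ee'.
by rewrite orbC.
Qed.

Lemma rel_degree_lt e e' v c : (forall w, e v w -> e' v w) ->
  e' v c -> ~~ e v c -> rel_degree e v < rel_degree e' v.
Proof.
move=> ee' e'c ec; apply/proper_card/properP; split.
  by apply/subsetP => w; rewrite !inE => /ee'.
by exists c; rewrite !inE.
Qed.

Lemma rel_excessS k e e' : subrel e e' -> rel_excess k e <= rel_excess k e'.
Proof.
move=> ee'; apply: leq_sum => v _; apply: leq_sub2r.
by apply: rel_degreeS => w; apply: ee'.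
Qed.

(** [h] is the distance from [r], and [p x] is the last but one vertex of a shortest path from [r]
    to [x]; the path without its end shows that [h] drops. *)
Lemma exists_parent e (r : V) : symmetric e -> (forall x, connect e r x) ->
  exists (p : V -> V) (h : V -> nat), p r = r /\
    forall x, x != r -> e x (p x) /\ h (p x) < h x.
Proof.
move=> es er.
pose Q x n := [exists s : n.-tuple V, path e r s && (last r s == x)].
have Qex x : exists n, Q x n.
  have /connectP[s ps ->] := er x.
  by exists (size s); apply/existsP; exists (in_tuple s); rewrite ps eqxx.
pose h x := ex_minn (Qex x).
suff [p pP] : exists p : V -> V, forall x,
    (x = r -> p x = r) /\ (x != r -> e x (p x) /\ h (p x) < h x).
  by exists p, h; split=> [|x /(proj2 (pP x))//]; apply: (pP r).1.
apply: (@fin_all_exists V (fun=> V) (fun x y =>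
  (x = r -> y = r) /\ (x != r -> e x y /\ h y < h x))) => x.
have [->|xr] := eqVneq x r; first by exists r.
have : Q x (h x) by rewrite /h; case: ex_minnP.
case/existsP => -[s /= /eqP sz] /andP[ps /eqP lx].
case/lastP: s => [|s y] in sz ps lx *; first by rewrite /= in lx; rewrite lx eqxx in xr.
move: ps lx; rewrite rcons_path last_rcons => /andP[ps ey] yx; subst y.
exists (last r s); split=> [xE|_]; first by rewrite xE eqxx in xr.
rewrite es; split=> //; rewrite -sz size_rcons ltnS {1}/h; case: ex_minnP => m _; apply.
by apply/existsP; exists (in_tuple s); rewrite ps eqxx.
Qed.

End RelDegree.

Section ParentTree.
Variables (V : finType) (r : V) (p : V -> V) (h : V -> nat).
Hypotheses (pr : p r = r) (hp : forall x, x != r -> h (p x) < h x).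
Implicit Types (S : {set V}) (x y w z : V).

Definition parent_rel : rel V :=
  fun x y => (x != r) && (y == p x) || (y != r) && (x == p y).

Lemma parent_rel_sym : symmetric parent_rel.
Proof. by move=> x y; rewrite /parent_rel orbC. Qed.

Lemma parent_rel_parent x : x != r -> parent_rel x (p x).
Proof. by move=> xr; rewrite /parent_rel xr eqxx. Qed.

Lemma parent_rel_irr : irreflexive parent_rel.
Proof.
move=> x; rewrite /parent_rel orbb; apply/negbTE/negP => /andP[/hp + /eqP xE].
by rewrite -xE ltnn.
Qed.

Definition parent_tree : sgraph V := SGraph parent_rel_sym parent_rel_irr.

(** * Ancestors, tree paths and components outside a vertex set *)

Definition anc w x := connect (frel p) x w.

Lemma anc_refl x : anc x x. Proof. exact: connect0. Qed.

Lemma ancE w x : anc w x = (w == x) || anc w (p x).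
Proof.
apply/idP/idP => [/connectP[[|y s] /=]|]; first by move=> _ ->; rewrite eqxx.
  by move=> /andP[/eqP <- ps] ->; apply/orP; right; apply/connectP; exists s.
case/orP=> [/eqP->|]; first exact: connect0.
by apply: connect_trans; apply: connect1 => /=.
Qed.

Lemma anc_trans w x y : anc w x -> anc x y -> anc w y.
Proof. by rewrite /anc => wx xy; apply: connect_trans xy wx. Qed.

Lemma parent_ind (P : V -> Prop) :
  P r -> (forall x, x != r -> P (p x) -> P x) -> forall x, P x.
Proof.
move=> P0 PS x; have [n] := ubnP (h x); elim: n x => // n IHn x.
rewrite ltnS => hx; have [->//|xr] := eqVneq x r.
by apply: PS => //; apply: IHn; apply: leq_trans (hp xr) hx.
Qed.

Lemma anc_root x : anc r x.
Proof.
elim/parent_ind: x => [|x xr IH]; first exact: anc_refl.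
by rewrite ancE IH orbT.
Qed.

Lemma anc_rank w x : anc w x -> w != x -> h w < h x.
Proof.
elim/parent_ind: x => [|x xr IH].
  rewrite ancE pr => /orP[/eqP->|]; first by rewrite eqxx.
  by case/connectP=> s; elim: s => [_ -> /eqP//|y s IHs /= /andP[/eqP + ps] wl];
    rewrite pr => yr; rewrite -yr in ps wl; apply: IHs.
rewrite ancE; case: (eqVneq w x) => //= _ wp _.
have [->|wpx] := eqVneq w (p x); first exact: hp.
exact: ltn_trans (IH wp wpx) (hp xr).
Qed.

Lemma anc_anti w x : anc w x -> anc x w -> w = x.
Proof.
move=> wx xw; apply/eqP/negPn/negP => wnx.
by have := ltn_trans (anc_rank wx wnx) (anc_rank xw _); rewrite ltnn eq_sym;
  move/(_ wnx).
Qed.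

Lemma parent_tree_connected : connected parent_tree.
Proof.
have to_r x : connect parent_rel x r.
  elim/parent_ind: x => [|x xr]; first exact: connect0.
  by apply: connect_trans; apply: connect1; apply: parent_rel_parent.
move=> x y; apply: connect_trans (to_r x) _.
by rewrite (sym_connect_sym parent_rel_sym).
Qed.

(* Both neighbours on a cycle of a vertex of maximal rank are its parent. *)
Lemma parent_tree_acyclic : acyclic parent_tree.
Proof.
move=> c c2 /andP[cyc uc].
have [x0 x0c] : exists x, x \in c.
  by case: c c2 {cyc uc} => // a c _; exists a; rewrite mem_head.
case: (arg_maxnP h x0c) => x xc xmax.
have [i s cE] := rot_to xc.
have := cyc; rewrite -(rot_cycle i) cE; have := uc; rewrite -(rot_uniq i) cE.
have : 2 < size (rot i c) by rewrite size_rot.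
have sub y : y \in x :: s -> h y <= h x by rewrite -cE mem_rot => /xmax.
rewrite {}cE; case: s sub => [//|y s] sub; case/lastP: s sub => [//|s z] sub _.
move=> /= /andP[_ /andP[ys _]] /andP[xy].
rewrite rcons_path last_rcons => /andP[_ zx].
have toparent a : a \in x :: y :: rcons s z -> parent_rel x a -> a = p x.
  move=> ain /orP[/andP[_ /eqP//]|/andP[ar /eqP xE]].
  by have := hp ar; rewrite -xE ltnNge sub.
have yE : y = p x by apply: toparent => //; rewrite inE mem_head orbT.
have zE : z = p x.
  apply: toparent; last by rewrite parent_rel_sym.
  by rewrite !inE mem_rcons mem_head !orbT.
by move: ys; rewrite yE -zE mem_rcons mem_head.
Qed.

(** A non-root [w] stands for the edge from [w] to [p w]. Deleting it cuts off the descendants of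
    [w], so it lies on the tree path from [x] to [y] exactly when one of the two descends from [w]
    and the other does not. *)
Definition path_edge x y w := anc w x (+) anc w y.

(** Replacing the end of larger rank by its parent removes exactly one edge from the path, which
    allows induction on [h x + h y]. *)
Lemma path_edge_const (A : Type) (f : V -> A) x y :
    (forall w, path_edge x y w -> f w = f (p w)) ->
  f x = f y /\ forall w, path_edge x y w -> f w = f x.
Proof.
have [n] := ubnP (h x + h y); elim: n x y => // n IHn x y.
wlog hxy : x y / h y <= h x => [W|].
  have [|/ltnW] := leqP (h y) (h x); first exact: W.
  move=> hyx hn fW; have [||E fE] := W y x hyx.
  - by rewrite addnC.
  - by move=> w; rewrite /path_edge addbC; apply: fW.
  split=> [|w]; first by rewrite E.
  by rewrite /path_edge addbC -E; apply: fE.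
rewrite ltnS => hn fW.
have [xy|xy] := eqVneq x y; first by subst y; split=> // w; rewrite /path_edge addbb.
have xr : x != r.
  apply: contraNneq xy => xr; apply: contraTT hxy => ynx.
  by rewrite -ltnNge xr; apply: anc_rank (anc_root y) _; rewrite -xr.
have nxy : ~~ anc x y by apply/negP => /anc_rank/(_ xy); rewrite ltnNge hxy.
have Wx : path_edge x y x by rewrite /path_edge anc_refl (negbTE nxy).
have WE w : path_edge x y w = (w == x) || path_edge (p x) y w.
  rewrite /path_edge (ancE w x); case: eqVneq => //= ->.
  by rewrite (negbTE nxy).
have [||E fE] := IHn (p x) y.
- by apply: leq_trans hn; rewrite ltn_add2r hp.
- by move=> w Ww; apply: fW; rewrite WE Ww orbT.
split=> [|w]; first by rewrite fW.
by rewrite WE => /orP[/eqP->//|/fE->]; rewrite -fW.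
Qed.

(** Climbing until the root or a child of [S] is reached gives, for [x] outside [S], the highest
    vertex of the component of T - S containing [x], which serves as the name of that component.
    Each real move lowers [h], so [\max_x h x] rounds suffice. *)
Definition up S x := if (x == r) || (p x \in S) then x else p x.
Definition top S x := iter (\max_x h x) (up S) x.

Lemma up_top S x : up S (top S x) = top S x.
Proof.
rewrite /top; have : h x <= \max_x h x by apply: leq_bigmax.
elim: (\max_x _) x => [|n IHn] x hx; rewrite ?iterSr.
  rewrite /= /up; have [//|/hp] := eqVneq x r.
  by move: hx; rewrite leqn0 => /eqP->.
have [E|xE] := eqVneq (up S x) x.
  have fix_x m : iter m (up S) x = x by elim: m => //= m ->.
  by rewrite E !fix_x.
apply: IHn; move: xE; rewrite /up; case: ifP; rewrite ?eqxx //.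
by case/norP=> xr _ _; rewrite -ltnS (leq_trans (hp xr)).
Qed.

Lemma top_up S x : top S (up S x) = top S x.
Proof. by rewrite /top -iterSr -/(top S x) -[RHS]up_top. Qed.

Lemma up_ind S x (P : V -> Prop) :
  (forall y, P y -> P (up S y)) -> P x -> P (top S x).
Proof. by move=> PS Px; rewrite /top; elim: (\max_x _) => //= n; apply: PS. Qed.

Lemma up_notin S x : x \notin S -> up S x \notin S.
Proof. by rewrite /up; case: ifP => // /norP[]. Qed.

Lemma top_notin S x : x \notin S -> top S x \notin S.
Proof. by move=> xS; apply: (@up_ind S x (fun y => y \notin S)) => // y /up_notin. Qed.

Lemma top_fixed S x : up S x = x -> top S x = x.
Proof. by rewrite /top => E; elim: (\max_x _) => //= n ->. Qed.

Lemma top_anc S x : anc (top S x) x.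
Proof.
apply: (@up_ind S x (fun y => anc y x)) => [y yx|]; last exact: anc_refl.
rewrite /up; case: ifP => // _; apply: anc_trans yx.
by rewrite ancE anc_refl orbT.
Qed.

Lemma top_parent S x : x != r -> p x \notin S -> top S (p x) = top S x.
Proof.
by move=> xr pS; rewrite -[RHS]top_up /up (negbTE xr) (negbTE pS).
Qed.

(** The climb for [S'] passes through the end of the climb for [S], so the components for [S] refine
    those for [S']. *)
Lemma top_top_sub S S' x : S' \subset S -> x \notin S ->
  top S' (top S x) = top S' x.
Proof.
move=> SS' xS.
suff [] : top S x \notin S /\ top S' (top S x) = top S' x by [].
apply: (@up_ind S x (fun y => y \notin S /\ top S' y = top S' x)) => // y [yS yE].
split; first exact: up_notin.
rewrite /up; case: ifP => // /norP[yr pyS]; rewrite top_parent //.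
by apply: contraNN pyS; apply: (subsetP SS').
Qed.

Lemma top_sub S S' x y : S' \subset S -> x \notin S -> y \notin S ->
  top S x = top S y -> top S' x = top S' y.
Proof. by move=> SS' xS yS E; rewrite -(top_top_sub SS' xS) E top_top_sub. Qed.

Lemma imset_top S :
  top S @: (~: S) = [set x in ~: S | (x == r) || (p x \in S)].
Proof.
apply/setP => x; rewrite !inE; apply/imsetP/andP => [[y]|[xS xt]].
  rewrite inE => yS ->; split; first exact: top_notin.
  have := up_top S y; rewrite /up; case: ifP => // /norP[nr _] E.
  by have := hp nr; rewrite E ltnn.
exists x; rewrite ?inE //.
by rewrite top_fixed // /up xt.
Qed.

(** * Degrees and the number of components *)

Lemma rel_degree_parent v :
  rel_degree parent_rel v = #|[set w | (w != r) && (p w == v)]| + (v != r).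
Proof.
rewrite /rel_degree.
have -> : [set w | parent_rel v w] =
    [set w | (w != r) && (p w == v)] :|: (if v == r then set0 else [set p v]).
  apply/setP => w; rewrite !inE /parent_rel orbC (eq_sym v (p w)).
  by case: (v == r); rewrite !inE.
rewrite cardsU; case: eqVneq => [|vr]; rewrite ?setI0 ?cards0 ?addn0 ?subn0 //.
rewrite cards1; suff -> : [set w | w != r & p w == v] :&: [set p v] = set0.
  by rewrite cards0 subn0.
apply/setP => w; rewrite !inE; apply/negbTE/negP.
case/andP=> /andP[/hp + /eqP pw] /eqP wE; rewrite pw wE.
by have := hp vr; lia.
Qed.

(** The degrees over [S] count the children of [S] and the non-root vertices of [S]. At most
    [#|S| - 1] of those children lie in [S]; the others are component tops, and the root is one more
    top if it is outside [S]. *)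
Lemma sum_degree_tops S : S != set0 ->
  \sum_(v in S) rel_degree parent_rel v + 2 <= #|top S @: (~: S)| + 2 * #|S|.
Proof.
move=> S0; rewrite imset_top.
pose Ch := [set w | (w != r) && (p w \in S)].
have -> : \sum_(v in S) rel_degree parent_rel v = #|Ch| + #|S :\ r|.
  under eq_bigr do rewrite rel_degree_parent.
  rewrite big_split /=; congr (_ + _).
    rewrite -sum1_card [RHS](partition_big p (mem S)) /=; last first.
      by move=> w; rewrite /Ch inE => /andP[].
    apply: eq_bigr => v vS; rewrite -sum1_card; apply: eq_bigl => w.
    by rewrite !inE -andbA; case: (eqVneq (p w) v) => [->|]; rewrite ?vS ?andbF.
  by rewrite -big_mkcondr /= -sum1_card; apply: eq_bigl => v; rewrite !inE andbC.
(* A vertex of [S] of least rank is not in [Ch]; this saves one inside [S]. *)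
have [z zS zmin] : exists2 z, z \in S & forall y, y \in S -> h z <= h y.
  by have [z0 z0S] := set0Pn _ S0; case: (arg_minnP h z0S) => z zS zm; exists z.
have ChS : #|Ch :&: S| < #|S|.
  apply: proper_card; apply/properP; split; first exact: subsetIr.
  exists z => //; rewrite !inE zS andbT; apply/negP => /andP[/hp + /zmin].
  by rewrite ltnNge => /negbTE ->.
have := cardsID S Ch; have := cardsD1 r S.
have -> : #|[set x in ~: S | (x == r) || (p x \in S)]| = #|Ch :\: S| + (r \notin S).
  have [rS|rS] := boolP (r \in S); rewrite ?addn0 /=.
    by apply: eq_card => x; rewrite !inE; case: eqVneq => [->|]; rewrite ?rS.
  have -> : [set x in ~: S | (x == r) || (p x \in S)] = r |: (Ch :\: S).
    by apply/setP => x; rewrite !inE; case: eqVneq => [->|]; rewrite ?rS.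
  by rewrite cardsU1 !inE eqxx rS addnC.
by case: (r \in S) => /=; lia.
Qed.

End ParentTree.

(** * Edge exchanges in a tree of minimal total excess *)

Section LocalExchange.
Variables (V : finType) (G : sgraph V) (k : nat).
Variables (r : V) (p : V -> V) (h : V -> nat).
Hypotheses (pr : p r = r) (hp : forall x, x != r -> h (p x) < h x).
Hypothesis pG : forall x, x != r -> G x (p x).
Implicit Types (S : {set V}) (x y w z v : V) (e : rel V).

Local Notation T := (parent_rel r p).
Local Notation top := (top r p h).
Local Notation path_edge := (path_edge p).

Lemma parent_rel_sub : subrel T G.
Proof.
move=> x y /orP[]/andP[zr /eqP->]; first exact: pG.
by rewrite edge_sym pG.
Qed.

(** For [v] outside [S] this is the component of T - S containing [v]. *)
Definition comp S v := [set x in ~: S | top S x == top S v].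

Definition restrict e (C : {set V}) : rel V :=
  fun x y => [&& x \in C, y \in C & e x y].

Lemma restrict_sym e C : symmetric e -> symmetric (restrict e C).
Proof. by move=> es x y; rewrite /restrict es andbCA. Qed.

Lemma mem_comp S v x : (x \in comp S v) = (x \notin S) && (top S x == top S v).
Proof. by rewrite !inE. Qed.

Lemma connect_comp S v x : x \in comp S v -> connect (restrict T (comp S v)) x (top S v).
Proof.
move=> xC; have := xC; rewrite mem_comp => /andP[xS /eqP E]; rewrite -E.
suff [] : top S x \in comp S v /\ connect (restrict T (comp S v)) x (top S x) by [].
apply: (@up_ind _ r p h S x (fun y => y \in comp S v /\
  connect (restrict T (comp S v)) x y)) => [y [yC cy]|]; last by split; rewrite ?connect0.
have uC : up r p S y \in comp S v.
  move: yC; rewrite !mem_comp => /andP[yS yE].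
  by rewrite up_notin // top_up.
split=> //; have [->//|uy] := eqVneq (up r p S y) y.
apply: connect_trans cy (connect1 _); rewrite /restrict yC uC.
move: uy; rewrite /up; case: ifP => [_|]; rewrite ?eqxx // => /norP[yr _] _.
exact: parent_rel_parent.
Qed.

(* A component of T - S can be replaced, inside itself, by a connected graph of
   maximum degree at most k in which v has degree below k. *)
Definition reducible S v := exists e,
  [/\ symmetric e, subrel e G,
      forall x y, ~~ ((x \in comp S v) && (y \in comp S v)) -> e x y = T x y,
      {in comp S v &, forall x y, connect (restrict e (comp S v)) x y} &
      {in comp S v, forall x, rel_degree e x <= k} /\ rel_degree e v < k].

(** The invariant while [S] shrinks. The first clause puts all the excess of the tree on [S], the
    second makes the degree sum over [S] equal to that excess plus [k * #|S|], and the third makes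
    room for one more edge at any vertex outside [S]. *)
Definition reduced S :=
  [/\ forall v, k < rel_degree T v -> v \in S,
      {in S, forall v, k <= rel_degree T v} &
      forall v, v \notin S -> reducible S v].

Lemma reduced_degree_ge : reduced [set v | k <= rel_degree T v].
Proof.
set S := [set v | _].
split=> [v /ltnW|v|v]; rewrite inE //; rewrite -ltnNge => vS; exists T; split=> //.
- exact: parent_rel_sym.
- exact: parent_rel_sub.
- move=> x y /connect_comp xC /connect_comp yC; apply: connect_trans xC _.
  by rewrite (sym_connect_sym (restrict_sym _ (parent_rel_sym r p))).
- split=> //.
  by move=> x; rewrite mem_comp inE -ltnNge => /andP[/ltnW].
Qed.

Lemma comp_sub S S' v : S' \subset S -> v \notin S -> comp S v \subset comp S' v.
Proof.
move=> SS' vS; apply/subsetP => x; rewrite !mem_comp => /andP[xS /eqP E].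
rewrite (top_sub hp SS' xS vS E) eqxx andbT.
by apply: contraNN xS; apply: (subsetP SS').
Qed.

(** The replacement inside the smaller component is kept, and the tree is used on the rest of the
    larger one. *)
Lemma reducibleS S S' v : S' \subset S -> v \notin S ->
  (forall x, x \notin S' -> rel_degree T x <= k) ->
  reducible S v -> reducible S' v.
Proof.
move=> SS' vS dT [e [es eG eT ec [ed ev]]]; exists e.
have CC' := comp_sub SS' vS.
have eT' x y : ~~ ((x \in comp S' v) && (y \in comp S' v)) -> e x y = T x y.
  move=> xy; apply: eT; apply: contraNN xy => /andP[xC yC].
  by rewrite !(subsetP CC').
have eC : subrel (restrict T (comp S' v)) (connect (restrict e (comp S' v))).
  move=> x y /and3P[xC' yC' Txy].
  have [/andP[xC yC]|nC] := boolP ((x \in comp S v) && (y \in comp S v)).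
    move: (ec x y xC yC); apply: connect_sub => a b /and3P[aC bC eab].
    by apply: connect1; rewrite /restrict !(subsetP CC').
  by apply: connect1; rewrite /restrict xC' yC' eT.
split=> //.
  move=> x y xC yC; apply: (@connect_trans _ _ (top S' v)).
    exact: (connect_sub eC (connect_comp xC)).
  rewrite (sym_connect_sym (restrict_sym _ es)).
  exact: (connect_sub eC (connect_comp yC)).
split=> // x xC'; have [/ed//|xC] := boolP (x \in comp S v).
apply: leq_trans (dT x _); last by move: xC'; rewrite mem_comp => /andP[].
by apply: rel_degreeS => y; rewrite eT // (negbTE xC).
Qed.

(** * Exchanging a path edge for an edge between two components *)

Section Exchange.
Variables (S S' : {set V}) (x y w v : V).
Hypotheses (redS : reduced S) (SS' : S' \subset S).
Hypotheses (xS : x \notin S) (yS : y \notin S) (Gxy : G x y).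
Hypothesis xy : top S x != top S y.
Hypothesis W' : forall u, path_edge x y u -> (u \notin S') && (p u \notin S').
Hypotheses (Ww : path_edge x y w) (vw : v \in [:: w; p w]) (vS : v \in S).

Lemma path_edge_neq_root u : path_edge x y u -> u != r.
Proof.
by apply: contraTneq => ->; rewrite /path_edge !(anc_root hp).
Qed.

Lemma path_edge_comp : y \in comp S' x /\
  forall u, path_edge x y u -> (u \in comp S' x) && (p u \in comp S' x).
Proof.
have wE u : path_edge x y u -> top S' u = top S' (p u).
  move=> Wu; have /andP[_ puS] := W' Wu.
  by rewrite (top_parent hp (path_edge_neq_root Wu)).
have [E H] := path_edge_const pr hp wE.
have sub z : z \notin S -> z \notin S' by apply: contraNN; apply: (subsetP SS').
split=> [|u Wu]; first by rewrite mem_comp E eqxx sub.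
by rewrite !mem_comp -(wE u Wu) (H u Wu) eqxx !andbT W'.
Qed.

(** The components of [x] and [y] in T - S are first replaced so that [x] and [y] have degree below
    [k]; then the edge from [w] to [p w] gives way to the edge between [x] and [y]. The degrees of
    [x] and [y] reach at most [k], and [v] loses an edge. *)
Lemma exchange : exists e,
  [/\ symmetric e, subrel e G,
      forall a b, ~~ ((a \in comp S' x) && (b \in comp S' x)) -> e a b = T a b,
      {in comp S' x &, forall a b, connect (restrict e (comp S' x)) a b} &
      (forall a, rel_degree e a <= maxn k (rel_degree T a)) /\
      rel_degree e v < rel_degree T v].
Proof.
have [_ _ red] := redS.
have [ex [exs exG exT exc [exd exx]]] := red x xS.
have [ey [eys eyG eyT eyc [eyd eyy]]] := red y yS.
have [yC' WC'] := path_edge_comp.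
have /andP[wC' pwC'] := WC' w Ww.
have xC' : x \in comp S' x.
  by rewrite mem_comp eqxx andbT; apply: contraNN xS; apply: (subsetP SS').
set C' := comp S' x in yC' WC' wC' pwC' xC' *.
set Cx := comp S x in exT exc exd.
set Cy := comp S y in eyT eyc eyd.
have wr : w != r := path_edge_neq_root Ww.
have xCx : x \in Cx by rewrite mem_comp eqxx xS.
have yCy : y \in Cy by rewrite mem_comp eqxx yS.
have dis a : a \in Cx -> a \in Cy -> False.
  rewrite !mem_comp => /andP[_ /eqP aE] /andP[_ /eqP].
  by rewrite aE => E; have := xy; rewrite E eqxx.
have subx : Cx \subset C' by apply: comp_sub.
have suby : Cy \subset C'.
  have -> : C' = comp S' y.
    apply/setP => z; rewrite !mem_comp; move: yC'; rewrite mem_comp.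
    by case/andP=> _ /eqP->.
  exact: comp_sub.
have vx : v \in Cx = false by rewrite mem_comp vS.
have vy : v \in Cy = false by rewrite mem_comp vS.
(* [f] carries both replacements, [wp] is the edge removed and [yx] the edge added. *)
pose f a b := if (a \in Cx) && (b \in Cx) then ex a b
  else if (a \in Cy) && (b \in Cy) then ey a b else T a b.
pose wp a b := (a == w) && (b == p w) || (b == w) && (a == p w).
pose yx a b := (a == x) && (b == y) || (b == x) && (a == y).
pose e : rel V := fun a b => f a b && ~~ wp a b || yx a b.
(* The removed edge has the end [v] in [S], so it never lies inside [Cx] or [Cy]. *)
have wp_in (C : {set V}) a b : v \notin C -> a \in C -> b \in C -> wp a b = false.
  move=> vC aC bC; apply/negbTE/negP => ab.
  have : (v == a) || (v == b).
    move: vw; rewrite !inE; case/orP: ab => /andP[/eqP-> /eqP->] //.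
    by rewrite orbC.
  by case/orP=> /eqP vE; rewrite vE ?aC ?bC in vC.
have fx a b : a \in Cx -> f a b = ex a b.
  move=> aC; rewrite /f aC /=; case: ifP => // bC.
  have -> : a \in Cy = false by apply/negbTE/negP => /(dis a aC).
  by rewrite /= exT // bC andbF.
have fy a b : a \in Cy -> f a b = ey a b.
  move=> aC; rewrite /f aC /=.
  have -> : a \in Cx = false by apply/negbTE/negP => /dis/(_ aC).
  by case: ifP => //= bC; rewrite eyT // bC andbF.
have fT a b : a \notin Cx -> a \notin Cy -> f a b = T a b.
  by rewrite /f => /negbTE-> /negbTE->.
have fs : symmetric f.
  move=> a b; rewrite /f [(b \in Cx) && _]andbC [(b \in Cy) && _]andbC.
  by rewrite exs eys parent_rel_sym.
have es : symmetric e.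
  have wps a b : wp a b = wp b a by rewrite /wp orbC.
  have yxs a b : yx a b = yx b a by rewrite /yx orbC.
  by move=> a b; rewrite /e fs wps yxs.
have eG : subrel e G.
  move=> a b /orP[/andP[+ _]|].
    by rewrite /f; case: ifP => [_ /exG//|_]; case: ifP => [_ /eyG//|_ /parent_rel_sub].
  by case/orP=> /andP[/eqP-> /eqP->] //; rewrite edge_sym.
have eT a b : ~~ ((a \in C') && (b \in C')) -> e a b = T a b.
  move=> ab; rewrite /e.
  have -> : wp a b = false.
    apply/negbTE; apply: contraNN ab.
    by case/orP=> /andP[/eqP-> /eqP->]; rewrite wC' pwC'.
  have -> : yx a b = false.
    apply/negbTE; apply: contraNN ab.
    by case/orP=> /andP[/eqP-> /eqP->]; rewrite xC' yC'.
  rewrite andbT orbF /f; case: ifP => [/andP[aC bC]|_].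
    by move: ab; rewrite !(subsetP subx).
  by case: ifP => // /andP[aC bC]; move: ab; rewrite !(subsetP suby).
exists e; split=> //; last split.
- have Ks := sym_connect_sym (restrict_sym C' es).
  have K1 a : a != r -> a != w -> a \in C' -> p a \in C' ->
      connect (restrict e C') a (p a).
    move=> ar aw aC' paC'.
    have [/andP[aC bC]|nx] := boolP ((a \in Cx) && (p a \in Cx)).
      move: (exc _ _ aC bC); apply: connect_sub => c d /and3P[cC dC cd].
      apply: connect1; rewrite /restrict !(subsetP subx) //= /e fx // cd.
      by rewrite (@wp_in Cx) // vx.
    have [/andP[aC bC]|ny] := boolP ((a \in Cy) && (p a \in Cy)).
      move: (eyc _ _ aC bC); apply: connect_sub => c d /and3P[cC dC cd].
      apply: connect1; rewrite /restrict !(subsetP suby) //= /e fy // cd.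
      by rewrite (@wp_in Cy) // vy.
    apply: connect1; rewrite /restrict aC' paC' /e /f (negbTE nx) (negbTE ny).
    rewrite parent_rel_parent //= /wp (negbTE aw) /=.
    case: eqVneq => //= paw; case: eqVneq => //= aE.
    have := hp ar; have := hp wr; rewrite paw -aE => h1 h2.
    by have := ltn_trans h1 h2; rewrite ltnn.
  (* Climbing in [C'] without the removed edge ends at [w] from below [w], and at the top of [C']
     from elsewhere. *)
  have K2 a : a \in C' ->
      connect (restrict e C') a (if anc p w a then w else top S' x).
    elim/(parent_ind hp): a => [|a ar IH] aC'.
      have rE : top S' r = r.
        have := top_anc r p h S' r; rewrite ancE pr.
        case/orP=> [/eqP//|rr]; apply: (anc_anti pr hp) rr (anc_root hp _).
      have -> : anc p w r = false.
        apply/negbTE/negP => wr'; move: wr.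
        by rewrite (anc_anti pr hp wr' (anc_root hp w)) eqxx.
      by move: aC'; rewrite mem_comp => /andP[_ /eqP<-]; rewrite rE connect0.
    have [aE|aw] := eqVneq a w; first by rewrite aE anc_refl connect0.
    have aS' : a \notin S' by move: aC'; rewrite mem_comp => /andP[].
    have aT : top S' a = top S' x by move: aC'; rewrite mem_comp => /andP[_ /eqP].
    have [paS|paS] := boolP (p a \in S').
      have aE : top S' a = a by rewrite top_fixed // /up paS orbT.
      case: ifP => wa; last by rewrite -aT aE connect0.
      case/eqP: aw; apply: (anc_anti pr hp _ wa).
      rewrite -aE aT; move: wC'; rewrite mem_comp => /andP[_ /eqP<-].
      exact: top_anc.
    have paC' : p a \in C' by rewrite mem_comp paS top_parent // aT eqxx.
    apply: connect_trans (K1 a ar aw aC' paC') _.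
    by rewrite (ancE p w a) eq_sym (negbTE aw); apply: IH.
  have Kxy : connect (restrict e C') x y.
    by apply: connect1; rewrite /restrict xC' yC' /e /yx !eqxx orbT.
  (* Exactly one of [x] and [y] lies below [w], so the new edge joins the two parts. *)
  have Kw : connect (restrict e C') w (top S' x).
    have := K2 x xC'; have := K2 y yC'; move: Ww; rewrite /path_edge.
    case: (anc p w x); case: (anc p w y) => //= _ Ky Kx.
      by rewrite Ks in Kx; apply: connect_trans Kx (connect_trans Kxy Ky).
    rewrite Ks in Ky; apply: connect_trans Ky _.
    by rewrite Ks in Kxy; apply: connect_trans Kxy Kx.
  have K3 a : a \in C' -> connect (restrict e C') a (top S' x).
    by move=> /K2; case: ifP => // _ aw; apply: connect_trans aw Kw.
  by move=> a b /K3 aC /K3; rewrite Ks; apply: connect_trans.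
- move=> a; rewrite leq_max; have [aC|aCx] := boolP (a \in Cx).
    apply/orP; left; have ay : a != y.
      by apply: contraTneq yCy => <-; apply/negP => /(dis a aC).
    have [->|ax] := eqVneq a x.
      apply: leq_trans exx; apply: (@rel_degree_leS _ _ _ _ y) => b.
      rewrite /e fx // /yx; case/orP=> [/andP[->]//|]; rewrite eqxx /=.
      by case/orP=> [->|/andP[_ /eqP xE]]; rewrite ?orbT //; have := xy; rewrite xE eqxx.
    apply: leq_trans (exd a aC); apply: rel_degreeS => b.
    by rewrite /e fx // /yx (negbTE ax) (negbTE ay) andbF !orbF => /andP[].
  have [aC|aCy] := boolP (a \in Cy).
    apply/orP; left; have ax : a != x by apply: contraNneq aCx => ->.
    have [->|ay] := eqVneq a y.
      apply: leq_trans eyy; apply: (@rel_degree_leS _ _ _ _ x) => b.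
      rewrite /e fy // /yx; case/orP=> [/andP[->]//|]; rewrite eqxx andbT.
      by case/orP=> [/andP[/eqP xE]|->]; rewrite ?orbT //; have := xy; rewrite xE eqxx.
    apply: leq_trans (eyd a aC); apply: rel_degreeS => b.
    by rewrite /e fy // /yx (negbTE ax) (negbTE ay) andbF !orbF => /andP[].
  apply/orP; right; apply: rel_degreeS => b.
  rewrite /e fT // /yx; have -> : (a == x) = false by apply: contraNF aCx => /eqP->.
  have -> : (a == y) = false by apply: contraNF aCy => /eqP->.
  by rewrite andbF /= orbF => /andP[].
- have vxF : (v == x) = false by apply: contraTF vS => /eqP->.
  have vyF : (v == y) = false by apply: contraTF vS => /eqP->.
  have eE b : e v b = T v b && ~~ wp v b.
    by rewrite /e fT ?vx ?vy // /yx vxF vyF andbF /= orbF.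
  apply: (@rel_degree_lt _ _ _ _ (if v == w then p w else w)) => [b||].
  + by rewrite eE => /andP[].
  + case: eqVneq => [->|]; first exact: parent_rel_parent.
    move: vw; rewrite !inE => /orP[->//|/eqP-> _].
    by rewrite parent_rel_sym parent_rel_parent.
  + rewrite eE /wp; case: eqVneq => [->|]; first by rewrite !eqxx andbF.
    by move: vw; rewrite !inE => /orP[->//|/eqP-> _]; rewrite !eqxx orbT andbF.
Qed.

End Exchange.

(** * Shrinking S while an edge joins two components *)

Hypothesis Tmin : forall e, symmetric e -> subrel e G ->
  (forall x y, connect e x y) -> rel_excess k T <= rel_excess k e.

(** [P] collects the vertices of [S] on the tree path from [x] to [y]. One of degree above [k] would
    let an exchange lower the total excess. So their degree is [k], and the exchange itself brings
    each of them below [k] within the merged component. *)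
Lemma reduced_step S x y : reduced S -> x \notin S -> y \notin S -> G x y ->
  top S x != top S y -> exists2 S' : {set V}, S' \proper S & reduced S'.
Proof.
move=> redS xS yS Gxy xy; have [Sgt Sge red] := redS.
pose P := [set v in S | [exists u, path_edge x y u && (v \in [:: u; p u])]].
have PP v : v \in P -> v \in S /\ exists2 u, path_edge x y u & v \in [:: u; p u].
  by rewrite inE => /andP[vS /existsP[u /andP[Wu vu]]]; split=> //; exists u.
pose S' := S :\: P.
have S'E v : (v \in S') = (v \notin P) && (v \in S) by rewrite inE.
have SS' : S' \subset S by apply: subsetDl.
have inP u v : path_edge x y u -> v \in [:: u; p u] -> v \notin S'.
  move=> Wu vu; rewrite S'E negb_and negbK inE.
  by case: (v \in S) => //=; rewrite orbF; apply/existsP; exists u; rewrite Wu.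
have W' u : path_edge x y u -> (u \notin S') && (p u \notin S').
  by move=> Wu; rewrite !(inP u) // !inE eqxx ?orbT.
have [yC' WC'] := path_edge_comp SS' yS W'.
have dP v : v \in P -> rel_degree T v <= k.
  case/PP=> vS [w Ww vw]; rewrite leqNgt; apply/negP => kv.
  have [e [es eG eT ec [ed ev]]] := exchange redS SS' xS yS Gxy xy W' Ww vw vS.
  have econn : forall a b, connect e a b.
    move=> a b; apply: connect_sub (parent_tree_connected hp a b) => {}a {}b ab.
    have [/andP[aC bC]|nC] := boolP ((a \in comp S' x) && (b \in comp S' x)).
      apply: connect_sub (ec a b aC bC) => c d /and3P[_ _ cd].
      exact: connect1.
    by apply: connect1; rewrite eT.
  have := Tmin es eG econn; apply/negP; rewrite -ltnNge.
  rewrite /rel_excess (bigD1 v) //= [X in _ < X](bigD1 v) //=.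
  rewrite -addSn leq_add //; first by rewrite ltn_sub2r.
  apply: leq_sum => a _; have := ed a; rewrite leq_max => /orP[da|/leq_sub2r->//].
  by move: da; rewrite -subn_eq0 => /eqP->.
have dS' v : v \notin S' -> rel_degree T v <= k.
  rewrite S'E negb_and negbK => /orP[/dP//|]; apply: contraNT.
  by rewrite -ltnNge => /Sgt.
exists S'; last first.
  split=> [v|v|v vS'].
  - by apply: contraTT => /dS'; rewrite -leqNgt.
  - by rewrite S'E => /andP[_ /Sge].
  have [vS|vS] := boolP (v \in S); last by apply: (reducibleS SS') (red v vS).
  have vP : v \in P by move: vS'; rewrite S'E vS andbT negbK.
  have [_ [w Ww vw]] := PP v vP.
  have [e [es eG eT ec [ed ev]]] := exchange redS SS' xS yS Gxy xy W' Ww vw vS.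
  have vE : comp S' v = comp S' x.
    have /andP[wC pwC] := WC' w Ww.
    have : v \in comp S' x by move: vw; rewrite in_cons mem_seq1 => /orP[]/eqP->.
    rewrite mem_comp => /andP[_ /eqP E].
    by apply/setP => z; rewrite !mem_comp E.
  exists e; rewrite vE; split=> //; split; last exact: leq_trans ev (dP v vP).
  move=> a; rewrite mem_comp => /andP[/dS' da _].
  by have := ed a; rewrite (maxn_idPl da).
(* [y] lies in the component of [x] for [S'] but not for [S], so the two sets differ. *)
rewrite properEneq SS' andbT; apply/eqP => E.
by have := yC'; rewrite E mem_comp eq_sym (negbTE xy) andbF.
Qed.

Lemma exists_reduced_closed : exists2 S : {set V}, reduced S &
  forall x y, x \notin S -> y \notin S -> G x y -> top S x = top S y.
Proof.
have := reduced_degree_ge; move: [set v | _] => S.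
have [n] := ubnP #|S|; elim: n S => // n IHn S; rewrite ltnS => Sn redS.
have [|no] := pselect (exists x y, [/\ x \notin S, y \notin S, G x y & top S x != top S y]).
  case=> x [y [xS yS Gxy xy]].
  have [S' /proper_card SS' redS'] := reduced_step redS xS yS Gxy xy.
  by apply: (IHn S') redS'; apply: leq_trans Sn.
exists S => // x y xS yS Gxy; apply/eqP/negPn/negP => xy; apply: no.
by exists x, y.
Qed.

End LocalExchange.

(** [t] sends a vertex to the top of its component. The total excess is at least [b + 1] and sits on
    [S], so the degrees over [S] sum to at least [k * #|S| + b + 1]; [sum_degree_tops] turns this
    into a count of components. *)
Lemma exists_excess_obstruction (V : finType) (G : sgraph V) (k b : nat) (r : V) :
  connected G ->
  (forall T : sgraph V, spanning_tree G T -> b < total_excess T k) ->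
  exists (S : {set V}) (t : V -> V),
    [/\ S != set0, forall x y, x \notin S -> y \notin S -> G x y -> t x = t y &
        k * #|S| + b + 3 <= #|t @: (~: S)| + 2 * #|S|].
Proof.
move=> Gconn noT.
(* The minimum runs over all connected spanning subgraphs, not only trees, so that an exchange has
   to preserve only connectedness; a spanning tree inside a minimiser is again a minimiser. *)
pose Q n := exists e : rel V, [/\ symmetric e, subrel e G,
  forall x y, connect e x y & rel_excess k e = n].
have exQ : exists n, `[< Q n >].
  exists (rel_excess k G); apply/asboolP; exists (edge G); split=> //.
  exact: edge_sym.
case: (ex_minnP exQ) => m /asboolP[e0 [e0s e0G e0c e0m]] mmin.
have [p [h [pr pP]]] := exists_parent e0s (e0c r).
have hp x : x != r -> h (p x) < h x by case/pP.
have pG x : x != r -> G x (p x) by case/pP=> /e0G.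
have Te0 : subrel (parent_rel r p) e0.
  by move=> x y /orP[]/andP[/pP[ez _] /eqP->] //; rewrite e0s.
have Tmin e : symmetric e -> subrel e G -> (forall x y, connect e x y) ->
    rel_excess k (parent_rel r p) <= rel_excess k e.
  move=> es eG ec; apply: leq_trans (rel_excessS k Te0) _; rewrite e0m.
  by apply: mmin; apply/asboolP; exists e.
have [S [Sgt Sge _] Scl] := exists_reduced_closed pr hp pG Tmin.
have Tb : b < rel_excess k (parent_rel r p).
  have := noT (parent_tree hp); apply; split; last exact: (parent_rel_sub pG).
  by split; [apply: parent_tree_connected|apply: parent_tree_acyclic].
have teE : rel_excess k (parent_rel r p) =
    \sum_(v in S) (rel_degree (parent_rel r p) v - k).
  rewrite [RHS]big_mkcond; apply: eq_bigr => v _; case: ifPn => // vS.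
  by apply/eqP; rewrite subn_eq0 leqNgt; apply: contraNN vS => /Sgt.
have S0 : S != set0.
  by apply: contraTneq Tb => SE; rewrite teE SE big_set0.
exists S, (top r p h S); split=> //.
have := sum_degree_tops hp S0.
have : \sum_(v in S) rel_degree (parent_rel r p) v =
    \sum_(v in S) (rel_degree (parent_rel r p) v - k) + k * #|S|.
  rewrite mulnC -sum_nat_const -big_split; apply: eq_bigr => v /Sge kv /=.
  by rewrite subnK.
rewrite -teE; move: Tb; clear; lia.
Qed.

(** * Eigenvalues of adjacency matrices *)

Section SpectralBounds.
Local Open Scope ring_scope.
Variables (R : realType) (V : finType) (G : sgraph V).
Implicit Types (lam mu : R) (x z : V -> R).

(** Eigenvectors for [eigenvalue] are row vectors; the symmetry of [G] lets them be read as
    functions on [V] with the matrix acting from the left. *)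
Lemma eigenvalue_adjacencyP mu :
  eigenvalue (adjacency_mx R G) mu <->
  exists2 z, exists u, z u != 0 & forall u, \sum_w (G u w)%:R * z w = mu * z u.
Proof.
have sumE z (u : V) : \sum_w (G u w)%:R * z w =
    \sum_(i : 'I_#|V|) z (enum_val i) * (G (enum_val i) u)%:R :> R.
  rewrite (reindex (@enum_val V predT)) /=; last exact: onW_bij (enum_val_bij V).
  apply: eq_bigr => i _.
  by rewrite mulrC edge_sym.
split=> [/eigenvalueP[v vA v0]|[z [u zu] zA]].
  exists (fun u => v ord0 (enum_rank u)) => [|u].
    move: v0; have [i vi _|v0] := pickP (fun i => v ord0 i != 0).
      by exists (enum_val i); rewrite enum_valK.
    case/eqP; apply/rowP => i; rewrite mxE; apply/eqP.
    by have := v0 i; move/negbT; rewrite negbK.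
  have /rowP/(_ (enum_rank u)) := vA; rewrite !mxE => <-.
  rewrite sumE; apply: eq_bigr => i _.
  by rewrite mxE enum_rankK enum_valK.
apply/eigenvalueP; exists (\row_i z (enum_val i)).
  apply/rowP => j; rewrite !mxE -zA sumE; apply: eq_bigr => i _.
  by rewrite !mxE.
apply: contraNneq zu => /rowP/(_ (enum_rank u)).
by rewrite !mxE enum_rankK => ->.
Qed.

(** * Positive supersolutions *)

Section Supersolution.
Variables (lam : R) (x : V -> R).
Hypothesis x_gt0 : forall u, 0 < x u.
Hypothesis x_super : forall u, \sum_w (G u w)%:R * x w <= lam * x u.

(* Compare |z| with x at a vertex where |z| / x is largest. *)
Lemma eigenvalue_extremal mu : eigenvalue (adjacency_mx R G) mu ->
  exists (M : R) (z : V -> R) (u0 : V),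
    [/\ 0 < M, forall u, `|z u| <= M * x u, `|z u0| = M * x u0 &
        forall u, `|mu| * `|z u| <= \sum_w (G u w)%:R * `|z w|].
Proof.
case/eigenvalue_adjacencyP => z [v zv] zA.
pose f u := `|z u| / x u.
have [u0 _ u0max] := @arg_maxP _ _ _ v xpredT f isT.
exists (f u0), z, u0; split.
- apply: lt_le_trans (u0max v isT); rewrite divr_gt0 ?x_gt0 //.
  by rewrite normr_gt0.
- by move=> u; rewrite -ler_pdivrMr ?x_gt0 //; apply: u0max.
- by rewrite /f divfK // gt_eqF ?x_gt0.
- move=> u; rewrite -normrM -zA; apply: le_trans (ler_norm_sum _ _ _) _.
  by apply: ler_sum => w _; rewrite normrM normr_nat.
Qed.

Lemma sum_dominated z (M : R) u : (forall w, `|z w| <= M * x w) ->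
  \sum_w (G u w)%:R * `|z w| <= M * \sum_w (G u w)%:R * x w.
Proof.
move=> zM; rewrite mulr_sumr; apply: ler_sum => w _.
by rewrite mulrCA ler_wpM2l.
Qed.

Lemma eigenvalue_le mu : eigenvalue (adjacency_mx R G) mu -> mu <= lam.
Proof.
case/eigenvalue_extremal => M [z [u0 [M0 zM z0 zA]]].
apply: le_trans (ler_norm _) _.
rewrite -(ler_pM2r (mulr_gt0 M0 (x_gt0 u0))) -{1}z0.
apply: le_trans (zA u0) _; apply: le_trans (sum_dominated _ zM) _.
by rewrite mulrCA ler_pM2l.
Qed.

(** The equality case in the manner of Perron and Frobenius: where [|z| = M * x], the same equality
    is forced at all neighbours, hence everywhere by connectedness; then the bounds for [z] leave no
    slack in the supersolution. *)
Lemma supersolution_tight mu : connected G ->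
  eigenvalue (adjacency_mx R G) mu -> lam <= mu ->
  forall u, \sum_w (G u w)%:R * x w = lam * x u.
Proof.
move=> Gc /eigenvalue_extremal[M [z [u0 [M0 zM z0 zA]]]] lm.
have tight u : `|z u| = M * x u ->
    M * (lam * x u) <= \sum_w (G u w)%:R * `|z w|.
  move=> zu; apply: le_trans (zA u); rewrite zu mulrCA ler_wpM2r //.
    by rewrite mulr_ge0 ?ltW.
  exact: le_trans lm (ler_norm _).
have step u w : G u w -> `|z u| = M * x u -> `|z w| = M * x w.
  move=> Guw zu; apply/eqP; rewrite eq_le zM leNgt; apply/negP => zw.
  have := tight u zu; apply/negP; rewrite -ltNge.
  apply: lt_le_trans (_ : _ < M * \sum_w (G u w)%:R * x w) _; last by rewrite ler_pM2l.
  rewrite mulr_sumr (bigD1 w) //= [ltRHS](bigD1 w) //= Guw !mul1r.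
  by apply: ltr_leD => //; apply: ler_sum => a _; rewrite mulrCA ler_wpM2l.
have all_max u : `|z u| = M * x u.
  have /connectP[s] := Gc u0 u; elim: s u0 z0 => [|a s IHs] v zv /=; first by move=> _ ->.
  by case/andP=> va ps uE; apply: (IHs a) => //; apply: step va zv.
move=> u; apply/eqP; rewrite eq_le x_super /= -(ler_pM2l M0).
apply: le_trans (tight u (all_max u)) _; exact: sum_dominated.
Qed.

Lemma spectral_radius_ge_tight : 0 < lam -> connected G ->
  lam <= spectral_radius R G -> forall u, \sum_w (G u w)%:R * x w = lam * x u.
Proof.
move=> lam0 Gc; rewrite /spectral_radius.
(* As [lam] is positive, the default value 0 of [xget] cannot be at least [lam]. *)
case: classical_sets.xgetP => [mu -> [mueig _] /(supersolution_tight Gc mueig)//|_].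
by rewrite leNgt lam0.
Qed.

End Supersolution.

(** A positive eigenvector is a supersolution, so its eigenvalue is the largest one and [xget] finds
    a value. *)
Lemma spectral_radius_ge lam x : (exists u : V, True) -> (forall u, 0 < x u) ->
  (forall u, \sum_w (G u w)%:R * x w = lam * x u) -> lam <= spectral_radius R G.
Proof.
move=> [u _] x0 xA.
have eig : eigenvalue (adjacency_mx R G) lam.
  by apply/eigenvalue_adjacencyP; exists x => //; exists u; rewrite gt_eqF.
have : is_largest_eigenvalue G (spectral_radius R G).
  apply: classical_sets.xgetPex; exists lam; split=> // mu.
  by apply: (eigenvalue_le x0) => v; rewrite xA.
by case=> _; apply.
Qed.

End SpectralBounds.

(** * The index of the extremal graph *)

Section ExtremalGraph.
Local Open Scope ring_scope.
Variable R : realType.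

(** The equation is that of the index of a cone over a clique of order [D] and [q] isolated
    vertices. Cleared of denominators it says that [P] vanishes, and [P] is negative at [D] and
    nonnegative at [D + q]. *)
Lemma exists_extremal_root (D q : nat) : (0 < q)%N ->
  exists2 lam : R, D%:R < lam & q%:R / lam + D%:R / (lam + 1 - D%:R) = lam.
Proof.
move=> q0; set d : R := D%:R; set a : R := q%:R.
have d0 : 0 <= d by rewrite ler0n.
have a1 : 1 <= a by rewrite ler1n.
pose P : {poly R} := ('X^2 - a%:P) * ('X + 1 - d%:P) - d%:P * 'X.
have PE y : P.[y] = (y ^+ 2 - a) * (y + 1 - d) - d * y by rewrite /P !hornerE.
have Pd : P.[d] = - a by rewrite PE; ring.
have [||lam /andP[dlam _] /rootP] := @poly_ivt _ P d (d + a).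
- by lra.
- rewrite Pd PE; apply/andP; split; first by lra.
  by nra.
rewrite PE => P0.
have {}dlam : d < lam.
  rewrite lt_neqAle dlam andbT; apply/eqP => dE.
  by move: Pd; rewrite dE PE P0; lra.
exists lam => //; have lam0 : lam != 0 by rewrite gt_eqF //; lra.
have l1 : lam + 1 - d != 0 by rewrite gt_eqF //; lra.
apply: (mulIf lam0); apply: (mulIf l1).
transitivity (lam * lam * (lam + 1 - d) - ((lam ^+ 2 - a) * (lam + 1 - d) - d * lam)).
  by field; rewrite lam0 l1.
by rewrite P0 subr0.
Qed.

(** The weights [x] form a positive eigenvector: with weight 1 at the join vertex, the rows of the
    other vertices determine their weights, and the row of the join vertex is the equation for
    [lam]. *)
Lemma extremal_spectral_radius_ge (n k b : nat) (lam : R) :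
  let D := (n - k - b - 1)%N in D%:R < lam ->
  (k + b)%:R / lam + D%:R / (lam + 1 - D%:R) = lam ->
  lam <= spectral_radius R (extremal_graph n k b).
Proof.
move=> D Dlam lamE; have D0 : 0 <= D%:R :> R by rewrite ler0n.
have lam0 : 0 < lam by lra.
have l1 : 0 < lam + 1 - D%:R by lra.
pose x (u : 'I_1 + ('I_D + 'I_(k + b))) : R := match u with
  | inl _ => 1 | inr (inl _) => (lam + 1 - D%:R)^-1 | inr (inr _) => lam^-1 end.
apply: (@spectral_radius_ge _ _ _ lam x).
- by exists (inl ord0).
- by case=> [_|[_|_]] /=; rewrite ?ltr01 ?invr_gt0.
move=> u; rewrite !big_sumType /= big_ord1 /=.
case: u => [i|[i|i]] /=.
- rewrite !ord1 /complete_rel eqxx mul0r add0r mulr1.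
  rewrite !sumr_const !card_ord !mul1r -[_ *+ D]mulr_natl -[_ *+ (k + b)]mulr_natl.
  by rewrite -[RHS]lamE addrC.
- rewrite mul1r; under [X in _ + (_ + X)]eq_bigr do rewrite mul0r.
  rewrite sumr_const mul0rn addr0 /complete_rel.
  rewrite (bigD1 i) //= eqxx mul0r add0r.
  under eq_bigr => j ji do rewrite eq_sym ji mul1r.
  rewrite sumr_const cardC1 card_ord -[_ *+ _]mulr_natl.
  have Dpos : (0 < D)%N by apply: leq_ltn_trans (ltn_ord i).
  have -> : D.-1%:R = D%:R - 1 :> R by rewrite -subn1 natrB.
  by field; rewrite gt_eqF.
- rewrite !mul1r; under eq_bigr do rewrite mul0r.
  under [X in _ + (_ + X)]eq_bigr do rewrite mul0r.
  by rewrite !sumr_const !mul0rn !addr0 divff // gt_eqF.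
Qed.

End ExtremalGraph.

(** * Graphs with many components outside S *)

Section Separator.
Local Open Scope ring_scope.
Variables (R : realType) (V : finType) (S : {set V}) (t : V -> V).
Implicit Types (u w : V).

(* The densest graph whose edges off S stay inside the fibres of t: every fibre
   becomes a clique, and S is joined to everything. *)
Definition saturation : rel V :=
  fun u w => (w != u) && [|| u \in S, w \in S | t u == t w].

Definition class_size u := #|[set w in ~: S | t w == t u]|.

Lemma class_size_gt0 u : u \notin S -> (0 < class_size u)%N.
Proof. by move=> uS; apply/card_gt0P; exists u; rewrite !inE uS eqxx. Qed.

Lemma class_size_eq u w : t u = t w -> class_size u = class_size w.
Proof. by rewrite /class_size => ->. Qed.

Lemma card_classes :
  #|~: S| = (\sum_(j in t @: (~: S)) #|[set w in ~: S | t w == j]|)%N.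
Proof.
rewrite -sum1_card (partition_big t (mem (t @: (~: S)))) /=; last first.
  by move=> w wS; apply: imset_f.
apply: eq_bigr => j _; rewrite -sum1_card; apply: eq_bigl => w.
by rewrite !inE.
Qed.

(** Each of the other fibres has at least one vertex. *)
Lemma class_size_le u : u \notin S ->
  (class_size u + #|t @: (~: S)| <= #|~: S| + 1)%N.
Proof.
move=> uS; have tu : t u \in t @: (~: S) by apply: imset_f; rewrite inE.
rewrite card_classes (bigD1 (t u)) //= -addnA leq_add2l (cardsD1 (t u)) tu addnC.
rewrite leq_add2r -sum1_card; under eq_bigl do rewrite !inE andbC.
apply: leq_sum => j /andP[/imsetP[w wS ->] _].
by apply/card_gt0P; exists w; rewrite !inE eqxx -in_setC wS.
Qed.

Lemma sum_inv_class_size :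
  \sum_(u in ~: S) (class_size u)%:R^-1 = #|t @: (~: S)|%:R :> R.
Proof.
rewrite (partition_big t (mem (t @: (~: S)))) /=; last first.
  by move=> w wS; apply: imset_f.
rewrite -sum1_card natr_sum; apply: eq_bigr => _ /imsetP[u uS ->].
transitivity (\sum_(w in [set w in ~: S | t w == t u]) (class_size u)%:R^-1 : R).
  by apply: eq_big => [w|w /andP[_ /eqP/class_size_eq->]]; rewrite ?inE.
rewrite sumr_const -[_ *+ _]mulr_natr mulVf // pnatr_eq0 -lt0n class_size_gt0 //.
by rewrite inE in uS.
Qed.

(** * Convexity over the component sizes *)

Variable lam : R.
Hypothesis lam_gt0 : 0 < lam.
Notation L := (lam + 1).

(* The gap between the chord over [1, N] of the convex function m / (L - m) and the
   function itself, divided by m. *)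
Lemma chord_gap (m N : R) : 1 <= m -> m <= N -> N < L ->
  m^-1 * (lam^-1 - L / ((L - N) * lam)) + L / ((L - N) * lam) - (L - m)^-1
  = L * (m - 1) * (N - m) / (m * lam * (L - N) * (L - m)).
Proof.
move=> m1 mN NL; have [m0 l0] : m != 0 /\ lam != 0.
  by split; rewrite gt_eqF //; lra.
have [LN Lm] : L - N != 0 /\ L - m != 0 by split; rewrite gt_eqF //; lra.
by field; rewrite m0 l0 LN Lm.
Qed.

(** Grouped by fibres, the sum is that of m / (L - m) over the fibre sizes m. By convexity it is
    largest for [c0 - 1] singletons and one fibre of size [N], which gives [B]; equality forces [c0]
    fibres with sizes at the ends of the chord. *)
Lemma sum_class_bound (c0 N : nat) :
    (0 < c0)%N -> (c0 <= #|t @: (~: S)|)%N -> (N + c0 = #|~: S| + 1)%N ->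
    N%:R < L ->
  let B := (c0 - 1)%:R / lam + N%:R / (L - N%:R) in
  \sum_(u in ~: S) (L - (class_size u)%:R)^-1 <= B /\
  (\sum_(u in ~: S) (L - (class_size u)%:R)^-1 = B -> #|t @: (~: S)| = c0 /\
     forall u, u \notin S -> class_size u = 1%N \/ class_size u = N).
Proof.
move=> c00 c0c NE NL B; set c := #|_| in c0c *.
have mb u : u \in ~: S -> 1 <= (class_size u)%:R :> R /\ (class_size u)%:R <= N%:R :> R.
  rewrite inE => uS; have := class_size_le uS; have := class_size_gt0 uS.
  by rewrite ler1n ler_nat -/c; move: c0c NE; clear; lia.
have [S0|[u0 u0S]] := set_0Vmem (~: S).
  by move: c0c c00; rewrite /c S0 imset0 cards0 leqn0 => /eqP->.
have N1 : 1 <= N%:R :> R by have [? ?] := mb _ u0S; lra.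
set n' : R := N%:R in mb NL N1 B *.
(* [Q] is the slope of the chord of m / (L - m) between m = 1 and m = N, and [lam^-1 - Q] is the
   value of the chord at 0. *)
pose Q : R := L / ((L - n') * lam).
have LN : 0 < L - n' by rewrite subr_gt0.
have QE : lam^-1 - Q = - n' / ((L - n') * lam).
  by rewrite /Q; field; rewrite !gt_eqF.
pose gap u : R := let m := (class_size u)%:R in
  L * (m - 1) * (n' - m) / (m * lam * (L - n') * (L - m)).
have gap0 u : u \in ~: S -> 0 <= gap u.
  move=> /mb[m1 mN]; rewrite /gap; apply: divr_ge0; repeat apply: mulr_ge0; lra.
have termE u : u \in ~: S -> (L - (class_size u)%:R)^-1 =
    (class_size u)%:R^-1 * (lam^-1 - Q) + Q - gap u.
  by move=> /mb[m1 mN]; rewrite /gap /Q -chord_gap //; ring.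
(* The defect from [B] splits into a term for the fibres beyond [c0] and the chord gaps, both
   nonnegative. *)
have cE : B = \sum_(u in ~: S) (L - (class_size u)%:R)^-1
    + (c%:R - c0%:R) * (Q - lam^-1) + \sum_(u in ~: S) gap u.
  rewrite (eq_bigr _ termE) big_split /= big_split /= -mulr_suml.
  rewrite sum_inv_class_size sumrN sumr_const -/c -[Q *+ _]mulr_natl.
  have -> : #|~: S|%:R = n' + c0%:R - 1 :> R.
    by rewrite /n' -natrD NE natrD addrK.
  rewrite /B natrB // /Q.
  by field; rewrite !gt_eqF.
have p1 : 0 <= (c%:R - c0%:R) * (Q - lam^-1).
  rewrite mulr_ge0 ?subr_ge0 ?ler_nat // -subr_le0 QE mulNr oppr_le0.
  by apply: divr_ge0; [lra|apply: mulr_ge0; lra].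
have p2 : 0 <= \sum_(u in ~: S) gap u by apply: sumr_ge0.
split=> [|E]; first by rewrite cE; lra.
have [E1 E2] : (c%:R - c0%:R) * (Q - lam^-1) = 0 /\ \sum_(u in ~: S) gap u = 0.
  by move: cE; rewrite E; lra.
split.
  move/eqP: E1; rewrite mulf_eq0 !subr_eq0 eqr_nat => /orP[/eqP//|/eqP QE'].
  have : - n' / ((L - n') * lam) < 0.
    by rewrite mulNr oppr_lt0 divr_gt0 ?mulr_gt0 //; lra.
  by rewrite -QE QE' subrr ltxx.
move=> u uS; have uS' : u \in ~: S by rewrite inE.
have := psumr_eq0P gap0 E2 uS'; have [m1 mN] := mb u uS'.
move/eqP; rewrite /gap !mulf_eq0 invr_eq0 !mulf_eq0.
have -> : (L == 0) = false by rewrite gt_eqF //; lra.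
have -> : ((class_size u)%:R == 0 :> R) = false by rewrite gt_eqF //; lra.
have -> : (lam == 0) = false by rewrite gt_eqF.
have -> : (L - n' == 0) = false by rewrite gt_eqF.
have -> : (L - (class_size u)%:R == 0) = false by rewrite gt_eqF //; lra.
rewrite !orbF /= !subr_eq0 /n' eqr_nat -[1]/(1%:R) eqr_nat.
by case/orP=> /eqP; [left|right].
Qed.

(** Off [S] the value solves s + (m - 1) x = lam x, with s the order of [S] and m the fibre size, so
    the eigenvalue equation of [saturation] is exact there. *)
Definition weight u : R :=
  if u \in S then 1 else #|S|%:R / (L - (class_size u)%:R).

Lemma saturation_sum_out u : u \notin S -> (class_size u)%:R < L ->
  \sum_w (saturation u w)%:R * weight w = lam * weight u.
Proof.
move=> uS mL; rewrite (bigID (mem S)) /=.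
rewrite (eq_bigr (fun=> 1)); last first.
  move=> w wS; rewrite /saturation /weight wS orbT andbT mulr1.
  by case: eqVneq wS uS => //= -> ->.
rewrite sumr_const.
rewrite (bigD1 u) //= {1}/saturation eqxx mul0r add0r.
rewrite (bigID (fun w => t w == t u)) /= [X in _ + (_ + X)]big1 ?addr0; last first.
  move=> w /andP[/andP[wS wu] tw].
  rewrite /saturation (negbTE uS) (negbTE wS) eq_sym in tw *.
  by rewrite (negbTE tw) andbF mul0r.
rewrite (eq_bigr (fun=> weight u)); last first.
  move=> w /andP[/andP[wS wu] /eqP tw].
  rewrite /saturation wu tw eqxx !orbT mul1r /weight (negbTE uS) (negbTE wS).
  by rewrite (class_size_eq tw).
rewrite sumr_const.
have -> : #|[pred w | (w \notin S) && (w != u) & t w == t u]| = (class_size u - 1)%N.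
  rewrite /class_size (cardsD1 u) !inE uS eqxx add1n subn1 /=.
  by apply: eq_card => w; rewrite !inE; case: (w \in S); case: (w == u).
rewrite -[_ *+ (_ - _)]mulr_natl natrB ?class_size_gt0 // /weight (negbTE uS).
by field; rewrite subr_eq0 gt_eqF.
Qed.

Lemma saturation_sum_in u : u \in S ->
  \sum_w (saturation u w)%:R * weight w =
  #|S|%:R - 1 + #|S|%:R * \sum_(w in ~: S) (L - (class_size w)%:R)^-1.
Proof.
move=> uS; rewrite (bigID (mem S)) /= (bigD1 u) //= {1}/saturation eqxx mul0r add0r.
congr (_ + _).
  rewrite (eq_bigr (fun=> 1)) => [|w /andP[wS wu]]; last first.
    by rewrite /saturation /weight wu uS wS mulr1.
  rewrite sumr_const (cardsD1 u S) uS natrD addrC addKr.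
  by congr _%:R; apply: eq_card => w; rewrite !inE andbC.
rewrite mulr_sumr; apply: eq_big => w; first by rewrite inE.
move=> wS; rewrite /saturation /weight uS (negbTE wS) andbT.
by have -> : w != u; [apply: contraNneq wS => ->|rewrite mul1r].
Qed.

End Separator.

(** * Recognising the extremal graph *)

Lemma isomorphic_extremal (V : finType) (G : sgraph V) (n k b : nat)
    (v : V) (B Z : {set V}) :
    #|B| = n - k - b - 1 -> #|Z| = k + b -> v \notin B -> v \notin Z ->
    [disjoint B & Z] -> k + b + 1 <= n -> #|V| = n ->
    (forall w, w != v -> G v w) -> {in B &, forall u w, G u w = (u != w)} ->
    {in B & Z, forall u w, ~~ G u w} -> {in Z &, forall u w, ~~ G u w} ->
  isomorphic G (extremal_graph n k b).
Proof.
move=> cB cZ vB vZ BZ kbn cV Gv GB GBZ GZ.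
pose g (a : 'I_1 + ('I_(n - k - b - 1) + 'I_(k + b))) : V := match a with
  | inl _ => v
  | inr (inl i) => enum_val (cast_ord (esym cB) i)
  | inr (inr j) => enum_val (cast_ord (esym cZ) j) end.
have gB i : g (inr (inl i)) \in B by apply: enum_valP.
have gZ j : g (inr (inr j)) \in Z by apply: enum_valP.
have nB w i : w \notin B -> (w == g (inr (inl i))) = false.
  by move=> wB; apply: contraNF wB => /eqP->.
have nZ w j : w \notin Z -> (w == g (inr (inr j))) = false.
  by move=> wZ; apply: contraNF wZ => /eqP->.
have BnZ w : w \in B -> w \notin Z by move=> wB; rewrite (disjointFr BZ).
have ginj : injective g.
  move=> [i|[i|i]] [j|[j|j]]; first by rewrite !ord1.
  - by move/eqP; rewrite nB.
  - by move/eqP; rewrite nZ.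
  - by move=> /esym/eqP; rewrite nB.
  - by move/enum_val_inj/cast_ord_inj->.
  - by move/eqP; rewrite nZ ?BnZ ?gB.
  - by move=> /esym/eqP; rewrite nZ.
  - by move=> /esym/eqP; rewrite nZ ?BnZ ?gB.
  - by move/enum_val_inj/cast_ord_inj->.
have [f fK gK] : bijective g.
  apply: inj_card_bij => //; rewrite !card_sum !card_ord cV.
  by move: kbn; clear; lia.
exists f; split=> [|x y]; first by exists g.
rewrite -{2}(gK x) -{2}(gK y); move: (f x) (f y) => {x y} a c.
case: a c => [i|[i|i]] [j|[j|j]]; rewrite /= ?(ord1 i) ?(ord1 j).
- by rewrite /complete_rel eqxx edge_irr.
- by rewrite Gv // eq_sym nB.
- by rewrite Gv // eq_sym nZ.
- by rewrite edge_sym Gv // eq_sym nB.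
- rewrite [RHS]GB ?gB // /complete_rel; congr (~~ _).
  by rewrite (inj_eq enum_val_inj) (inj_eq (@cast_ord_inj _ _ _)).
- by apply/esym/negbTE/GBZ; [apply: (gB i)|apply: (gZ j)].
- by rewrite edge_sym Gv // eq_sym nZ.
- by rewrite edge_sym; apply/esym/negbTE/GBZ; [apply: (gB j)|apply: (gZ i)].
- by apply/esym/negbTE/GZ; [apply: (gZ i)|apply: (gZ j)].
Qed.

(** Some fibre [B] has size [n - k - b - 1]: if all were single, then n - 1 = k + b + 1 and that
    size is itself 1. The other [k + b] vertices carry [k + b] labels, so [v] is their only
    neighbour. *)
Lemma saturation_isomorphic (V : finType) (G : sgraph V) (n k b : nat)
    (v : V) (t : V -> V) :
    #|V| = n -> k + b + 2 <= n -> G =2 saturation [set v] t ->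
    #|t @: (~: [set v])| = k + b + 1 ->
    (forall u, u != v -> class_size [set v] t u = 1 \/
                         class_size [set v] t u = n - k - b - 1) ->
  isomorphic G (extremal_graph n k b).
Proof.
move=> cV kbn GE cc csize; set S := [set v] in GE cc csize.
have cS : #|~: S| = n - 1 by rewrite cardsC1 cV subn1.
have [u0 u0v u0D] : exists2 u, u != v & class_size S t u = n - k - b - 1.
  have [D1|Dn1] := eqVneq (n - k - b - 1) 1.
    have /card_gt0P[u] : 0 < #|~: S| by rewrite cS; move: kbn; clear; lia.
    rewrite !inE => uv; exists u => //; by case: (csize u uv) => ->.
  have [u uP|no] := pickP (fun u => (u != v) && (class_size S t u == n - k - b - 1)).
    by case/andP: uP => uv /eqP; exists u.
  have cs1 u : u != v -> class_size S t u = 1.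
    by move=> uv; have := no u; rewrite uv; case: (csize u uv) => -> //; rewrite eqxx.
  have := card_classes S t; rewrite (eq_bigr (fun=> 1)) => [|_ /imsetP[u uS ->]].
    by rewrite sum1_card cS cc; move: kbn Dn1; clear; lia.
  by apply: cs1; rewrite !inE in uS.
pose B := [set w in ~: S | t w == t u0].
pose Z := ~: S :\: B.
have cB : #|B| = n - k - b - 1 by [].
have BS : B \subset ~: S by apply/subsetP => w; rewrite inE => /andP[].
have cZ : #|Z| = k + b.
  by rewrite cardsD (setIidPr BS) cB cS; move: kbn; clear; lia.
have tZ : {in Z &, injective t}.
  apply/imset_injP; rewrite cZ -(eqn_add2r 1) -cc addn1 -add1n.
  have -> : t @: (~: S) = t u0 |: t @: Z.
    apply/setP => j; rewrite !inE; apply/imsetP/idP => [[w wS ->]|].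
      have [//|tw] := eqVneq (t w) (t u0); apply: imset_f.
      by move: wS; rewrite !inE => ->; rewrite (negbTE tw).
    case/orP=> [/eqP->|/imsetP[w]]; first by exists u0; rewrite ?inE.
    by rewrite !inE => /andP[_ wS] ->; exists w; rewrite ?inE.
  rewrite cardsU1; case: imsetP => // -[w]; rewrite !inE => /andP[+ wv] tw.
  by rewrite wv tw eqxx.
have vB : v \notin B by rewrite !inE eqxx.
have vZ : v \notin Z by rewrite !inE eqxx andbF.
have notv w : w \in ~: S -> w != v by rewrite !inE.
apply: (@isomorphic_extremal _ _ _ _ _ v B Z) => //.
- by rewrite -setI_eq0; apply/eqP/setP => w; rewrite !inE; case: (w == v); case: (t w == _).
- by move: kbn; clear; lia.
- by move=> w wv; rewrite GE /saturation wv inE eqxx.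
- move=> u w uB wB; rewrite GE /saturation eq_sym.
  move: uB wB; rewrite !inE => /andP[_ /eqP->] /andP[_ /eqP->].
  by rewrite eqxx !orbT andbT.
- move=> u w; rewrite GE /saturation !inE => /andP[uv /eqP uB] /andP[+ wv].
  rewrite wv (negbTE uv) (negbTE wv) uB /= => wB.
  by rewrite [t u0 == _]eq_sym (negbTE wB) andbF.
- move=> u w uZ wZ; rewrite GE /saturation; apply/negP.
  have uv : u != v by apply: notv; move: uZ; rewrite inE => /andP[].
  have wv : w != v by apply: notv; move: wZ; rewrite inE => /andP[].
  rewrite !inE (negbTE uv) (negbTE wv) /= => /andP[wu /eqP tuw].
  by rewrite (tZ _ _ uZ wZ tuw) eqxx in wu.
Qed.

(** * A numerical inequality for separators of at least two vertices *)

(** This is q + (q + 1)(C / D + N / E) <= D multiplied by D E, where C = (K - 1)(q + 1) + B, D = N +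
    K q and E = K q + 1. For N = q = 1 and K = 4 it reads 110 <= 100 at B = 4 and 100 <= 100 at B =
    3, hence the excluded pair. *)
Lemma separator_arith (N q K B : nat) : 0 < N -> 0 < q -> 4 <= K -> B <= K ->
    (B, K) <> (4, 4) ->
  (q + 1) * (((K - 1) * (q + 1) + B) * (K * q + 1) + N * (N + K * q)) <=
  (N + (K - 1) * q) * (N + K * q) * (K * q + 1).
Proof.
case: N q => [//|N] [//|q] _ _ K4 BK BK4.
have [K5|K5] := leqP 5 K.
  apply: (@leq_trans ((q.+1 + 1) * (((K - 1) * (q.+1 + 1) + K) * (K * q.+1 + 1) +
    N.+1 * (N.+1 + K * q.+1)))).
    by rewrite leq_mul2l leq_add2r leq_mul2r leq_add2l BK !orbT.
  by case: K K5 {K4 BK BK4} => [|[|[|[|[|K]]]]] // _; nia.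
have K4E : K = 4 by move: K4 K5; clear; lia.
subst K; have B3 : B <= 3.
  rewrite leqNgt; apply/negP => B4; apply: BK4; congr pair.
  by apply/eqP; rewrite eqn_leq BK.
apply: (@leq_trans ((q.+1 + 1) * (((4 - 1) * (q.+1 + 1) + 3) * (4 * q.+1 + 1) +
    N.+1 * (N.+1 + 4 * q.+1)))).
  by rewrite leq_mul2l leq_add2r leq_mul2r leq_add2l B3 !orbT.
by clear; nia.
Qed.

(** As [lam] exceeds D = N + K q, also lam + 1 - N exceeds E = K q + 1; putting D and E for these
    denominators reduces the claim to [separator_arith]. *)
Lemma separator_value_lt (R : realFieldType) (lam : R) (N q K B : nat) :
    0 < N -> 0 < q -> 4 <= K -> B <= K -> (B, K) <> (4, 4) ->
    ((N + K * q)%:R < lam)%R ->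
  (q%:R + (q + 1)%:R *
    (((K - 1) * (q + 1) + B)%:R / lam + N%:R / (lam + 1 - N%:R)) < lam)%R.
Proof.
move=> N0 q0 K4 BK BK4; have := separator_arith N0 q0 K4 BK BK4.
set C := (K - 1) * (q + 1) + B; set D := N + K * q; set E := K * q + 1.
move=> H Dlam; have qD : q <= D by rewrite /D; move: K4; clear; nia.
have DE : N + (K - 1) * q = D - q by rewrite /D; move: K4; clear; nia.
rewrite {}DE in H.
have D0 : (0 < D%:R :> R)%R by rewrite ltr0n /D addn_gt0 N0.
have E0 : (0 < E%:R :> R)%R by rewrite ltr0n /E addn1.
have lE : (E%:R <= lam + 1 - N%:R)%R.
  by move: Dlam; rewrite /D /E !natrD; lra.
have l0 : (0 < lam)%R by lra.
apply: (le_lt_trans _ Dlam).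
have -> : (D%:R = q%:R + (D - q)%:R :> R)%R by rewrite -natrD subnKC.
rewrite lerD2l; apply: (@le_trans _ _ ((q + 1)%:R * (C%:R / D%:R + N%:R / E%:R))%R).
  rewrite ler_wpM2l ?ler0n //; apply: lerD; rewrite ler_wpM2l ?ler0n //.
    by rewrite lef_pV2 ?posrE // ltW.
  by rewrite lef_pV2 ?posrE //; lra.
rewrite addf_div ?gt_eqF // mulrA ler_pdivrMr ?mulr_gt0 // -!natrM -!natrD -!natrM ler_nat.
by rewrite mulnA.
Qed.

(** * Spectral comparison with the extremal graph *)

Lemma separator_isomorphic (R : realType) (k b n : nat) (V : finType)
    (G : sgraph V) (S : {set V}) (t : V -> V) :
    maxn 5 (b + 3) <= k -> (b, k) <> (2, 5) -> connected G -> #|V| = n ->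
    k + b + 2 <= n ->
    (spectral_radius R (extremal_graph n k b) <= spectral_radius R G)%R ->
    S != set0 -> (forall x y, x \notin S -> y \notin S -> G x y -> t x = t y) ->
    k * #|S| + b + 3 <= #|t @: (~: S)| + 2 * #|S| ->
  isomorphic G (extremal_graph n k b).
Proof.
rewrite geq_max => /andP[k5 bk] hbk Gc cV kbn rho S0 tG cS.
have [lam Dlam lamE] : exists2 lam : R, ((n - k - b - 1)%:R < lam)%R &
    ((k + b)%:R / lam + (n - k - b - 1)%:R / (lam + 1 - (n - k - b - 1)%:R) = lam)%R.
  by apply: exists_extremal_root; move: k5; clear; lia.
have D0 : (0 <= (n - k - b - 1)%:R :> R)%R by rewrite ler0n.
have lam0 : (0 < lam)%R by lra.
have {}rho := le_trans (extremal_spectral_radius_ge Dlam lamE) rho.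
have s0 : 0 < #|S| by rewrite card_gt0.
set s := #|S| in s0 cS.
set c := #|t @: (~: S)| in cS.
have cC : #|~: S| = n - s by rewrite cardsCs setCK cV.
have cle : c <= n - s by rewrite -cC leq_imset_card.
(* [c0] is the number of components that [cS] guarantees, and [N] the order of the largest one when
   there are exactly [c0] and the others are single vertices. *)
pose c0 := (k - 2) * s + b + 3.
have c0E : c0 + 2 * s = k * s + b + 3.
  by rewrite /c0; move: k5; clear; nia.
have c0c : c0 <= c by move: cS c0E; clear; lia.
pose N := n - s + 1 - c0.
have NE : N + c0 = #|~: S| + 1 by rewrite cC /N; move: c0c cle; clear; lia.
have N0 : 0 < N by rewrite /N; move: c0c cle; clear; lia.
have DE : n - k - b - 1 = N + (k - 1) * (s - 1).
  by move: c0E NE k5 s0 cle c0c; rewrite cC /c0; clear; nia.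
have ND : (N%:R <= (n - k - b - 1)%:R :> R)%R by rewrite ler_nat DE leq_addr.
have NL : (N%:R < lam + 1)%R by lra.
have c00 : 0 < c0 by rewrite /c0 addn3.
have [Sbound Stight] := sum_class_bound lam0 c00 c0c NE NL.
set F := (\sum_(u in _) _)%R in Sbound Stight.
set x := weight S t lam.
have mL u : u \notin S -> ((class_size S t u)%:R < lam + 1 :> R)%R.
  move=> uS; apply: le_lt_trans NL; rewrite ler_nat.
  by have := class_size_le t uS; rewrite -/c; move: c0c NE; clear; lia.
have x0 u : (0 < x u)%R.
  rewrite /x /weight; case: ifPn => // uS.
  by rewrite divr_gt0 ?ltr0n // subr_gt0 mL.
have Gsat u w : G u w -> saturation S t u w.
  move=> Guw; rewrite /saturation; apply/andP; split.
    by apply: contraTneq Guw => ->; rewrite edge_irr.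
  have [//|uS] := boolP (u \in S); have [//|wS] := boolP (w \in S).
  by rewrite (tG _ _ uS wS Guw) eqxx.
have Gle u w : ((G u w)%:R * x w <= (saturation S t u w)%:R * x w)%R.
  rewrite ler_pM2r // ler_nat; case: (boolP (G u w)) => // /Gsat.
  by rewrite lt0b => ->.
have Gsum u : (\sum_w (G u w)%:R * x w <= \sum_w (saturation S t u w)%:R * x w)%R.
  by apply: ler_sum.
have xS u : u \in S -> x u = 1%R by rewrite /x /weight => ->.
have satS u : u \in S -> (\sum_w (saturation S t u w)%:R * x w = s%:R - 1 + s%:R * F)%R.
  exact: saturation_sum_in.
have satN u : u \notin S -> (\sum_w (saturation S t u w)%:R * x w = lam * x u)%R.
  by move=> uS; apply: saturation_sum_out => //; apply: mL.
have [s1|sn1] := eqVneq s 1; last first.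
  have s2 : (s%:R - 1 + s%:R * F < lam)%R.
    (* By [DE] the bound [N + K * q] is here the clique order [n - k - b - 1]; the excluded pair (4,
       4) corresponds to (b, k) = (2, 5). *)
    have := @separator_value_lt R lam N (s - 1) (k - 1) (b + 2) N0.
    have -> : (k - 1 - 1) * (s - 1 + 1) + (b + 2) = c0 - 1.
      by rewrite subnK // /c0 -subnDA; clear; lia.
    rewrite -DE subnK // (natrB _ s0) => s2.
    apply: le_lt_trans (s2 _ _ _ _ Dlam); first by rewrite lerD2l ler_pM2l // ltr0n.
    - by move: s0 sn1; clear; lia.
    - by move: k5; clear; lia.
    - by move: bk; clear; lia.
    - by move=> [b2 k4]; apply: hbk; congr pair; move: b2 k4 k5; clear; lia.
  have sup u : (\sum_w (G u w)%:R * x w <= lam * x u)%R.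
    apply: le_trans (Gsum u) _.
    have [uS|uS] := boolP (u \in S); last by rewrite satN.
    by rewrite satS // xS // mulr1 ltW.
  have [v vS] := set0Pn _ S0.
  have := spectral_radius_ge_tight x0 sup lam0 Gc rho v.
  rewrite xS // mulr1 => vE; move: s2; rewrite -(satS v vS) -[ltRHS]vE ltNge.
  by rewrite Gsum.
have [v SE] := cards1P (introT eqP s1 : #|S| == 1).
(* For s = 1 the convexity bound is the left side of the equation defining [lam]. *)
have BE : ((c0 - 1)%:R / lam + N%:R / (lam + 1 - N%:R) = lam)%R.
  have -> : c0 - 1 = k + b by rewrite /c0 s1; move: k5; clear; lia.
  by have -> : N = n - k - b - 1 by rewrite DE s1 subnn muln0 addn0.
rewrite BE in Sbound Stight.
have satle u : (\sum_w (saturation S t u w)%:R * x w <= lam * x u)%R.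
  have [uS|uS] := boolP (u \in S); last by rewrite satN.
  by rewrite satS // xS // s1 subrr add0r mul1r mulr1.
have sup u : (\sum_w (G u w)%:R * x w <= lam * x u)%R.
  exact: le_trans (Gsum u) (satle u).
have tight := spectral_radius_ge_tight x0 sup lam0 Gc rho.
have vS : v \in S by rewrite SE inE.
have FE : F = lam.
  apply: le_anti; rewrite Sbound /=.
  have := Gsum v; rewrite tight satS // xS //.
  by rewrite s1 subrr add0r mul1r mulr1.
have [cc csize] := Stight FE.
(* An edge of the saturation missing from [G] would make the inequality strict at its end [u]. *)
have GE : G =2 saturation S t.
  move=> u w; apply/idP/idP; first exact: Gsat.
  move=> sat; apply/negPn/negP => nG.
  have := satle u; rewrite -tight leNgt; apply/negP; rewrite negbK.
  rewrite (bigD1 w) //= [ltRHS](bigD1 w) //= sat (negbTE nG) mul0r mul1r.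
  by rewrite ltr_leD //; apply: ler_sum.
apply: (@saturation_isomorphic _ _ _ _ _ v t) => //.
- by rewrite -SE.
- by rewrite -SE cc /c0 s1; move: k5; clear; lia.
- move=> u uv; rewrite -SE.
  have -> : n - k - b - 1 = N by rewrite DE s1 subnn muln0 addn0.
  by apply: csize; rewrite SE inE.
Qed.

Theorem theorem1p1 (R : realType) (k b n : nat) (V : finType) (G : sgraph V)
    (hk : maxn 5 (b + 3) <= k)
    (hbk : (b, k) <> (2, 5))
    (hconn : connected G)
    (hV : #|V| = n)
    (hn : k + b + 2 <= n)
    (hrho : (spectral_radius R (extremal_graph n k b) <= spectral_radius R G)%R)
    (hext : ~ isomorphic G (extremal_graph n k b)) :
  exists T : sgraph V, spanning_tree G T /\ total_excess T k <= b.
Proof.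
have [r _] : exists r : V, r \in V.
  by apply/card_gt0P; rewrite hV; move: hn; clear; lia.
apply: contra_notP hext => noT.
have [T GT|S [t [S0 tG cS]]] := @exists_excess_obstruction V G k b r hconn.
  by rewrite ltnNge; apply/negP => Tb; apply: noT; exists T.
exact: (@separator_isomorphic R k b n V G S t).
Qed.
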